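(* There exists an integer $N$ such that, for every integer $d$ greater than $N$ and every non-negative real number $t$ less than $\sqrt{d}/2$, $$ \left|\frac{\sqrt{d}}{(d-1)!}A\biggl(d,\biggl\lceil\frac{d}{2}-\sqrt{d}\,t\biggr\rceil\biggr)-\sqrt{\frac{6}{\pi}}\,e^{-6t^2}\right|\leq\frac{7e^{12/\sqrt{d}}}{\sqrt{\pi d}}. $$
   Context: The Eulerian numbers $A(d,i)$ are defined for all pairs of positive integers $d$ and $i$ such that $i<d$ by $A(d,1)=A(d,d-1)=1$ for every integer $d\geq2$ and by the recurrence relation $$ A(d,i)=(d-i)A(d-1,i-1)+iA(d-1,i) $$ for $2\leq i\leq d-2$. *)

(* Defs.v *)
From mathcomp Require Import all_boot.

Set Implicit Arguments.
Unset Strict Implicit.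
Unset Printing Implicit Defensive.

(* [eulerian d i] is the Eulerian number A(d, i) in the convention where the
   index runs over 1 <= i <= d - 1 and the row d sums to (d - 1)!.  Outside
   this range A(d, i) is undefined and [eulerian d i] is the dummy value 0. *)
Fixpoint eulerian (d i : nat) : nat :=
  if d is d'.+1 then
    if (0 < i < d)%N then
      if (i == 1%N) || (i == d.-1) then 1%N
      else ((d - i) * eulerian d' i.-1 + i * eulerian d' i)%N
    else 0%N
  else 0%N.

Lemma eulerian_first (d : nat) : (2 <= d)%N -> eulerian d 1 = 1%N.
Proof. by case: d => [|[|d]]. Qed.

Lemma eulerian_last (d : nat) : (2 <= d)%N -> eulerian d d.-1 = 1%N.
Proof. by case: d => [|[|d]] //= _; rewrite ltnSn eqxx orbT. Qed.

Lemma eulerian_rec (d i : nat) : (2 <= i)%N -> (i <= d - 2)%N ->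
  eulerian d i =
    ((d - i) * eulerian (d - 1) (i - 1) + i * eulerian (d - 1) i)%N.
Proof.
case: d => [|d] i2 id; first by move: (leq_trans i2 id).
have lt_id : (i < d)%N.
  by case: d id => [|d] id; [move: (leq_trans i2 id) | rewrite !subSS subn0 in id].
rewrite !subn1 /= (ltnS i d) (ltnW lt_id) (ltn_eqF lt_id) (gtn_eqF i2).
by rewrite (ltnW i2).
Qed.

(* Main.v *)
Require Import Defs.
From mathcomp Require Import all_boot all_order all_algebra.
From mathcomp Require Import all_classical all_reals all_analysis.
From mathcomp Require Import measurable_realfun ring lra.

(** The number A(d, i) / (d - 1)! is the density at i of a sum of d
independent uniform variables on [0, 1], so the theorem is a local limit
theorem for that sum, and it is proved by Fourier inversion.  Writing
s u = sin u / u, the inversion formula reads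

  A(d, i) / (d - 1)! = (2 / pi) * int_0^oo s(u)^d cos (2 (i - d/2) u) du.

It is proved without any probability ([sincint_eulerian]): integrating the
derivative of s^n sin u cos (2xu) over the half-line shows that the integrals
satisfy the Eulerian recurrence ([sincint_rec]), and the recurrence starts
from the integral of s^2 cos (2xu), a hat function of x ([sincint2]).  The
latter is a combination of integrals of (1 - cos bu) / u^2, whose integrand is
nonnegative, so that Tonelli's theorem applies after 1 / u^2 is written as the
integral of s exp(- su) ([integral_one_sub_cos]).

Near the origin s(u) is close to exp(- u^2/6), and the cosine transform of
exp(- d u^2/6) is a Gaussian in x ([gaussintE], from the differential equation
satisfied by the transform).  Both functions differ by at most u^4, and both
have a square at most 1 / (1 + u^2/4); telescoping the difference of their
d-th powers therefore leaves an integrable bound, and the two transforms differ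
by O(d^(-3/2)) uniformly in x ([sincint_gaussint_dist]).  After multiplication
by the square root of d, the Eulerian number is within O(1/d) of the Gaussian
at i ([eulerian_gauss_dist]).

The only error of order 1 / sqrt d comes from rounding d/2 - t sqrt d to the
next integer, which moves the argument of the Gaussian by at most 1 / sqrt d.
Since exp(- 6 a^2) has Lipschitz constant at most sqrt 6
([gauss6_lipschitz]), rounding costs at most
sqrt (6/pi) * sqrt 6 / sqrt d = 6 / sqrt (pi d).  The stated constant 7 leaves
1 / sqrt (pi d), which dominates the O(1/d) term for large d; the exponential
factor of the bound is at least 1. *)

Import Order.TTheory GRing.Theory Num.Theory.
Import numFieldNormedType.Exports.

Set Implicit Arguments.
Unset Strict Implicit.
Unset Printing Implicit Defensive.

Local Open Scope classical_set_scope.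
Local Open Scope ring_scope.

(** * Taylor bounds for the cardinal sine *)

Section sinc_bounds.
Context {R : realType}.
Implicit Types u : R.

(** Each application integrates an inequality once; starting from cos x <= 1, or
from 1 - x <= exp(- x), this yields the alternating Taylor bounds below. *)
Lemma derive_ge0_ge0 (F f : R -> R) u :
  (forall x : R, is_derive x 1 F (f x)) -> F 0 = 0 ->
  (forall x, 0 <= x -> 0 <= f x) -> 0 <= u -> 0 <= F u.
Proof.
move=> dF F0 f0 u0.
have cF : {within `[0, u], continuous F}.
  apply: derivable_within_continuous => x _.
  exact: (@ex_derive _ _ _ _ _ _ _ (dF x)).
have [c] := MVT_segment u0 (fun x _ => dF x) cF.
rewrite in_itv/= F0 !subr0 => /andP[c0 _] ->.
by rewrite mulr_ge0// f0.
Qed.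

Lemma sin_le u : 0 <= u -> sin u <= u.
Proof.
move=> u0; rewrite -subr_ge0.
apply: (@derive_ge0_ge0 (fun u => u - sin u) (fun u => 1 - cos u)) => //.
by rewrite sin0 subrr.
Qed.

Lemma cos_ge u : 0 <= u -> 1 - u ^+ 2 / 2 <= cos u.
Proof.
move=> u0; rewrite -subr_ge0.
apply: (@derive_ge0_ge0 (fun u => cos u - (1 - u ^+ 2 / 2))
  (fun u => u - sin u)) => //.
- by move=> x; apply: is_derive_eq; rewrite /GRing.scale/=; field.
- by rewrite cos0; ring.
- by move=> x x0; rewrite subr_ge0 sin_le.
Qed.

Lemma sin_ge u : 0 <= u -> u - u ^+ 3 / 6 <= sin u.
Proof.
move=> u0; rewrite -subr_ge0.
apply: (@derive_ge0_ge0 (fun u => sin u - (u - u ^+ 3 / 6))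
  (fun u => cos u - (1 - u ^+ 2 / 2))) => //.
- by move=> x; apply: is_derive_eq; rewrite /GRing.scale/=; field.
- by rewrite sin0; ring.
- by move=> x x0; rewrite subr_ge0 cos_ge.
Qed.

Lemma norm_sin_le u : `|sin u| <= `|u|.
Proof.
wlog u0 : u / 0 <= u.
  move=> H; have [|u0] := leP 0 u; first exact: H.
  by rewrite -normrN -sinN -(normrN u); apply: H; rewrite oppr_ge0 ltW.
rewrite (ger0_norm u0) ler_norml sin_le// andbT.
have [u1|u1] := leP 1 u; first by rewrite (le_trans _ (sin_geN1 u))// lerN2.
have := sin_ge u0; have u3 : u ^+ 3 <= u by rewrite ler_iXnr// ltW.
lra.
Qed.

Lemma cos_le u : 0 <= u -> cos u <= 1 - u ^+ 2 / 2 + u ^+ 4 / 24.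
Proof.
move=> u0; rewrite -subr_ge0.
apply: (@derive_ge0_ge0 (fun u => 1 - u ^+ 2 / 2 + u ^+ 4 / 24 - cos u)
  (fun u => sin u - (u - u ^+ 3 / 6))) => //.
- by move=> x; apply: is_derive_eq; rewrite /GRing.scale/=; field.
- by rewrite cos0; ring.
- by move=> x x0; rewrite subr_ge0 sin_ge.
Qed.

Lemma sin_le_taylor5 u : 0 <= u -> sin u <= u - u ^+ 3 / 6 + u ^+ 5 / 120.
Proof.
move=> u0; rewrite -subr_ge0.
apply: (@derive_ge0_ge0 (fun u => u - u ^+ 3 / 6 + u ^+ 5 / 120 - sin u)
  (fun u => 1 - u ^+ 2 / 2 + u ^+ 4 / 24 - cos u)) => //.
- by move=> x; apply: is_derive_eq; rewrite /GRing.scale/=; field.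
- by rewrite sin0; ring.
- by move=> x x0; rewrite subr_ge0 cos_le.
Qed.

Lemma expRN_le u : 0 <= u -> expR (- u) <= 1 - u + u ^+ 2 / 2.
Proof.
move=> u0; rewrite -subr_ge0.
apply: (@derive_ge0_ge0 (fun u => 1 - u + u ^+ 2 / 2 - expR (- u))
  (fun u => expR (- u) - (1 - u))) => //.
- by move=> x; apply: is_derive_eq; rewrite /GRing.scale/=; field.
- by rewrite oppr0 expR0; ring.
- by move=> x x0; rewrite subr_ge0 expR_ge1Dx.
Qed.

Definition sinc u := sin u / u.

(** Both functions lie between 1 - u^2/6 and 1 - u^2/6 + u^4/72.  These Taylor
bounds hold on the whole half-line, so no splitting into small and large [u] is
needed later. *)
Lemma sinc_gauss_dist u : 0 < u -> `|sinc u - expR (- (u ^+ 2 / 6))| <= u ^+ 4.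
Proof.
move=> u0; have u2 : 0 <= u ^+ 2 / 6 by rewrite divr_ge0 ?sqr_ge0.
have e1 := expR_ge1Dx (- (u ^+ 2 / 6)); have e2 := expRN_le u2.
have s1 : 1 - u ^+ 2 / 6 <= sinc u.
  rewrite /sinc ler_pdivlMr//; have := sin_ge (ltW u0); lra.
have s2 : sinc u <= 1 - u ^+ 2 / 6 + u ^+ 4 / 120.
  rewrite /sinc ler_pdivrMr//; have := sin_le_taylor5 (ltW u0); lra.
rewrite ler_norml; have u4 : 0 <= u ^+ 4 by rewrite exprn_ge0// ltW.
apply/andP; split; lra.
Qed.

(** A majorant valid for all [u]: for large [u] it follows from |sin u| <= 1,
for small [u] from sinc u <= 1 - u^2/7.  Unlike the Gaussian bound, which fails
for large [u], it only gives a polynomial decay for the powers of [sinc], but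
that is enough for integrability. *)
Lemma sinc_sqr_le u : 0 < u -> sinc u ^+ 2 <= (1 + u ^+ 2 / 4)^-1.
Proof.
move=> u0; rewrite -[leRHS]mul1r ler_pdivlMr; last first.
  by rewrite ltr_wpDr// divr_ge0// sqr_ge0.
have sE : sin u = sinc u * u by rewrite /sinc divfK ?gt_eqF.
(* The threshold is flexible: above it sin^2 <= 1 suffices, below it the
   quintic Taylor bound does. *)
have [u2|u2] := leP 2 (u ^+ 2).
  have : sin u ^+ 2 <= 1 by rewrite sin2cos2 gerBl sqr_ge0.
  rewrite sE exprMn => h.
  have : 0 <= sinc u ^+ 2 by rewrite sqr_ge0.
  set a := sinc u ^+ 2 in h *; set b := u ^+ 2 in h u2 *; move=> a0.
  have : a * 2 <= a * b by rewrite ler_wpM2l.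
  lra.
have s1 : 1 - u ^+ 2 / 6 <= sinc u.
  rewrite /sinc ler_pdivlMr//; have := sin_ge (ltW u0); lra.
have s2 : sinc u <= 1 - u ^+ 2 / 6 + u ^+ 4 / 120.
  rewrite /sinc ler_pdivrMr//; have := sin_le_taylor5 (ltW u0); lra.
have : 0 < u ^+ 2 by rewrite exprn_gt0.
have u4E : u ^+ 4 = u ^+ 2 * u ^+ 2 by rewrite -exprD.
rewrite u4E in s2.
set b := u ^+ 2 in s1 s2 u2 *; move=> b0.
have sb : sinc u <= 1 - b / 7.
  have : b * b <= b * 2 by rewrite ler_wpM2l// ltW.
  lra.
have s0 : 0 <= sinc u by lra.
apply: (@le_trans _ _ ((1 - b / 7) ^+ 2 * (1 + b / 4))).
  rewrite ler_wpM2r//; first lra.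
  rewrite ler_pXn2r// nnegrE; lra.
nra.
Qed.

Lemma is_derive_sinc u : 0 < u -> is_derive u 1 sinc ((cos u - sinc u) / u).
Proof.
move=> u0; have un0 : id u != 0 :> R by rewrite gt_eqF.
have dV := @is_deriveV R id u 1 1 un0 (is_derive_id u 1).
have -> : sinc = (fun u => sin u * (id u)^-1) by [].
apply: is_derive_eq; rewrite /GRing.scale/= /sinc; field.
by rewrite gt_eqF.
Qed.

End sinc_bounds.

(** * Integrals over the positive half-line *)

Section half_line.
Context {R : realType}.
Local Notation mu := (@lebesgue_measure R).
Local Notation D := (`]0%R, +oo[%classic : set R).

Lemma is_derive_continuous (f : R -> R) (u l : R) :
  is_derive u 1 f l -> {for u, continuous f}.
Proof.
by case=> df _; apply: differentiable_continuous; apply/derivable1_diffP.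
Qed.

Lemma pos_measurable (f : R -> R) :
  (forall u, 0 < u -> {for u, continuous f}) -> measurable_fun D f.
Proof.
move=> cf; apply: open_continuous_measurable_fun => // u.
by rewrite inE/= in_itv/= andbT => /cf.
Qed.

(** Continuity is only asked on the open half-line: [sinc] is 0 at 0, because
0^-1 = 0, hence discontinuous there. *)
Lemma le_pos_integrable (f g : R -> R) :
  (forall u, 0 < u -> {for u, continuous f}) ->
  mu.-integrable D (EFin \o g) -> (forall u, 0 < u -> `|f u| <= g u) ->
  mu.-integrable D (EFin \o f).
Proof.
move=> cf ig fg; apply: le_integrable ig => //.
  by apply/measurable_EFinP; apply: pos_measurable.
move=> u/=; rewrite in_itv/= andbT => u0.
by rewrite lee_fin (le_trans (fg _ u0))// ler_norm.
Qed.

Lemma pos_integrableZ (k : R) (f : R -> R) : mu.-integrable D (EFin \o f) ->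
  mu.-integrable D (EFin \o (fun u => k * f u)).
Proof.
by move=> If; apply: (eq_integrable _ _ _ _ (integrableZl _ k If)).
Qed.

Lemma pos_integrableD (f g : R -> R) : mu.-integrable D (EFin \o f) ->
  mu.-integrable D (EFin \o g) ->
  mu.-integrable D (EFin \o (fun u => f u + g u)).
Proof.
by move=> If Ig; apply: (eq_integrable _ _ _ _ (integrableD _ If Ig)).
Qed.

Lemma pos_integrableB (f g : R -> R) : mu.-integrable D (EFin \o f) ->
  mu.-integrable D (EFin \o g) ->
  mu.-integrable D (EFin \o (fun u => f u - g u)).
Proof.
by move=> If Ig; apply: (eq_integrable _ _ _ _ (integrableB _ If Ig)).
Qed.

(** The antiderivative is atan (ru) / r.  These functions dominate all the
oscillating integrands below. *)
Lemma integral_cauchy (r : R) : 0 < r ->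
  (\int[mu]_(u in D) ((1 + (r * u) ^+ 2)^-1)%:E = (pi / 2 / r)%:E)%E.
Proof.
move=> r0.
have den u : 1 + (r * u) ^+ 2 != 0 by rewrite gt_eqF// ltr_pwDl// sqr_ge0.
have dV (u : R) : is_derive u 1 (fun u => (1 + (r * u) ^+ 2)^-1)
    (- (1 + (r * u) ^+ 2) ^- 2 * (2 * r ^+ 2 * u)).
  have dd : is_derive u 1 (fun u => 1 + (r * u) ^+ 2) (2 * r ^+ 2 * u).
    by apply: is_derive_eq; rewrite /GRing.scale/=; ring.
  by have := @is_deriveV R (fun u => 1 + (r * u) ^+ 2) u _ 1 (den u) dd.
have dA (u : R) : is_derive u 1 (fun u => atan (r * u) / r) ((1 + (r * u) ^+ 2)^-1).
  apply: is_derive_eq; rewrite /GRing.scale/=; field.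
  by rewrite den gt_eqF.
rewrite integral_itv_obnd_cbnd; last first.
  apply/measurable_EFinP; apply: pos_measurable => u _.
  exact: is_derive_continuous (dV u).
rewrite (@ge0_continuous_FTC2y _ _ (fun u => atan (r * u) / r) _ (pi / 2 / r)).
- by rewrite mulr0 atan0 mul0r sube0.
- by move=> u _; rewrite invr_ge0 addr_ge0// sqr_ge0.
- apply: derivable_within_continuous => u _.
  exact: (@ex_derive _ _ _ _ _ _ _ (dV u)).
- apply: cvgM; last exact: cvg_cst.
  apply: (@cvg_comp _ _ _ (fun u => r * u) (@atan R) _ (pinfty_nbhs R)).
    exact/gt0_cvgMry.
  exact: cvgy_atan.
- by move=> u _; exact: (@ex_derive _ _ _ _ _ _ _ (dA u)).
- apply: cvg_at_right_filter.
  exact: is_derive_continuous (dA 0).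
- by move=> u _; rewrite derive1E; exact: (@derive_val _ _ _ _ _ _ _ (dA u)).
Qed.

Lemma integrable_cauchy (r : R) : 0 < r ->
  mu.-integrable D (EFin \o (fun u => (1 + (r * u) ^+ 2)^-1)).
Proof.
move=> r0; apply/integrableP; split.
  apply/measurable_EFinP/measurable_funTS.
  apply: continuous_measurable_fun => u.
  apply: cvgV; first by rewrite gt_eqF// ltr_pwDl// sqr_ge0.
  apply: cvgD; first exact: cvg_cst.
  apply: (@cvg_comp _ _ _ (fun u => r * u) (fun v => v ^+ 2)).
    by apply: cvgM; [exact: cvg_cst|exact: cvg_id].
  exact: exprn_continuous.
under eq_integral do rewrite /= ger0_norm ?invr_ge0 ?addr_ge0 ?sqr_ge0//.
by rewrite integral_cauchy// ltry.
Qed.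

(** The two bounds on [F] say that it vanishes at 0 and at infinity.  The
integral of its derivative over [1/n, n] is F n - F (1/n), which tends to 0, and
dominated convergence identifies its limit with the integral over the
half-line.  This is how both integrations by parts below are performed. *)
Lemma Rintegral_derive_eq0 (C : R) (F f : R -> R) :
  (forall u : R, 0 < u -> is_derive u 1 F (f u)) ->
  (forall u, 0 < u -> {for u, continuous f}) ->
  mu.-integrable D (EFin \o f) ->
  (forall u, 0 < u -> `|F u| <= C * u) ->
  (forall u, 0 < u -> `|F u| <= C / u) ->
  \int[mu]_(u in D) f u = 0.
Proof.
move=> dF cf intf F0 Foo.
pose I (n : nat) : set R := `[n.+2%:R^-1, n.+2%:R]%classic.
have n2 n : 0 < n.+2%:R :> R by rewrite ltr0n.
have ID n : I n `<=` D.
  move=> u; rewrite /I/= !in_itv/= andbT => /andP[+ _].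
  by apply: lt_le_trans; rewrite invr_gt0.
have lim1 : (fun n => \int[mu]_(u in D) ((f \_ (I n)) u)%:E)%E @ \oo
   --> (\int[mu]_(u in D) (f u)%:E)%E.
  have [||||||_ _ //] := @dominated_convergence _ _ _ mu D _
    (fun n u => ((f \_ (I n)) u)%:E)
    (fun u => (f u)%:E) (fun u => `|f u|%:E).
  - by [].
  - move=> n; apply/measurable_EFinP/(measurable_restrict _ _ _) => //.
      exact: measurable_itv.
    apply: (measurable_funS _ _ (pos_measurable cf)) => //; exact: subIsetl.
  - by apply/measurable_EFinP; apply: pos_measurable.
  - apply/aeW => u; rewrite /= in_itv/= andbT => u0.
    apply: cvg_near_cst.
    near=> n; congr EFin; rewrite patchE mem_set// /I/= in_itv/=.
    have h : u + u^-1 <= n%:R by near: n; exact: nbhs_infty_ger.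
    have h2 : n%:R <= n.+2%:R :> R by rewrite ler_nat -addn2 leq_addr.
    apply/andP; split.
      rewrite -[leRHS]invrK lef_pV2 ?posrE ?invr_gt0//.
      by apply: le_trans h2; apply: le_trans h; rewrite lerDr ltW.
    by apply: le_trans h2; apply: le_trans h; rewrite lerDl invr_ge0 ltW.
  - by move/integrable_norm : intf.
  - apply/aeW => u n _; rewrite /= lee_fin patchE.
    by case: ifPn => // _; rewrite normr0.
have IE n : (\int[mu]_(u in D) ((f \_ (I n)) u)%:E)%E =
    (F n.+2%:R - F n.+2%:R^-1)%:E.
  transitivity (\int[mu]_(u in D) (((EFin \o f) \_ (I n)) u))%E.
    by apply: eq_integral => u _; rewrite !patchE; case: ifPn.
  rewrite -integral_mkcondr setIidr; last exact: ID.
  rewrite (@continuous_FTC2 _ f F)//.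
  - by rewrite (@lt_trans _ _ 1)// ?invf_lt1 ?ltr1n.
  - apply: continuous_in_subspaceT => u; rewrite inE => /ID.
    by rewrite /= in_itv/= andbT => /cf.
  - have dd u : 0 < u -> {for u, continuous F}.
      by move=> u0; exact: is_derive_continuous (dF _ u0).
    split.
    + move=> u; rewrite in_itv/= => /andP[nu _].
      have u0 : 0 < u by rewrite (lt_trans _ nu)// invr_gt0.
      exact: (@ex_derive _ _ _ _ _ _ _ (dF _ u0)).
    + by apply/cvg_at_right_filter/dd; rewrite invr_gt0.
    + exact/cvg_at_left_filter/dd.
  - move=> u; rewrite in_itv/= => /andP[nu _].
    have u0 : 0 < u by rewrite (lt_trans _ nu)// invr_gt0.
    by rewrite derive1E; exact: (@derive_val _ _ _ _ _ _ _ (dF _ u0)).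
(* By [Foo] at n + 2 and [F0] at its inverse, both boundary terms are at most
   C / (n + 2). *)
have lim2 : (fun n => \int[mu]_(u in D) ((f \_ (I n)) u)%:E)%E @ \oo --> 0%E.
  under eq_fun do rewrite IE.
  apply: cvg_EFin; first exact: nearW.
  apply: norm_cvg0.
  apply: (@squeeze_cvgr _ _ _ _ (cst 0) (fun n => 2 * C * n.+1%:R^-1)).
  - apply: nearW => n /=; rewrite normr_ge0/=.
    rewrite (le_trans (ler_normB _ _))// -mulrA.
    have h1 := Foo _ (n2 n); have := F0 n.+2%:R^-1; rewrite invr_gt0 => /(_ (n2 n)) h2.
    have C0 : 0 <= C.
      by rewrite -(@pmulr_lge0 _ n.+2%:R^-1) ?invr_gt0//; apply: le_trans h1.
    have : C * n.+2%:R^-1 <= C * n.+1%:R^-1.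
      by rewrite ler_wpM2l// lef_pV2 ?posrE ?ltr0n// ler_nat.
    move: (C * n.+1%:R^-1) (C * n.+2%:R^-1) `|F _| `|F _| h1 h2.
    by clear => *; lra.
  - exact: cvg_cst.
  - rewrite -[X in _ --> X](mulr0 (2 * C)).
    by apply: cvgM; [exact: cvg_cst|exact: cvg_harmonic].
by rewrite /Rintegral (cvg_unique _ lim1 lim2).
Unshelve. all: by end_near. Qed.

End half_line.

(** * Cosine transforms of powers of the cardinal sine *)

Section sinc_power_integral.
Context {R : realType}.
Local Notation mu := (@lebesgue_measure R).
Local Notation D := (`]0%R, +oo[%classic : set R).

(** Up to the factor pi/2 this is the density at [x] of the sum of [d]
independent uniform variables on [-1/2, 1/2], whose characteristic function is
a power of [sinc]; by parity of the integrand the inversion integral is taken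
over the half-line only. *)
Definition sincint (d : nat) (x : R) :=
  \int[mu]_(u in D) (sinc u ^+ d * cos (2 * x * u)).

Lemma norm_sinc_le1 (u : R) : 0 < u -> `|sinc u| <= 1.
Proof.
move=> u0; rewrite -(@ler_pXn2r _ 2) ?nnegrE// expr1n real_normK ?num_real//.
rewrite (le_trans (sinc_sqr_le u0))// invf_le1 ?lerDl ?divr_ge0 ?sqr_ge0//.
by rewrite ltr_wpDr// divr_ge0 ?sqr_ge0.
Qed.

Lemma norm_sincXM_le (d : nat) (u y : R) : (1 < d)%N -> 0 < u -> `|y| <= 1 ->
  `|sinc u ^+ d * y| <= (1 + (2^-1 * u) ^+ 2)^-1.
Proof.
move=> d2 u0 y1; rewrite normrM normrX.
have -> : 1 + (2^-1 * u) ^+ 2 = 1 + u ^+ 2 / 4 by field.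
apply: le_trans (sinc_sqr_le u0).
rewrite -[leRHS]mulr1 ler_pM// ?exprn_ge0//.
rewrite -[leRHS]real_normK ?num_real//.
by rewrite ler_wiXn2l// norm_sinc_le1.
Qed.

Lemma is_derive_sincX (d : nat) (u : R) : 0 < u ->
  is_derive u 1 (fun u => sinc u ^+ d)
    (d%:R * sinc u ^+ d.-1 * ((cos u - sinc u) / u)).
Proof.
move=> u0; have := @is_deriveX _ _ _ d _ _ _ (is_derive_sinc u0).
by rewrite exprfctE.
Qed.

Lemma sincX_cos_continuous (d : nat) (x u : R) : 0 < u ->
  {for u, continuous (fun u => sinc u ^+ d * cos (2 * x * u))}.
Proof.
move=> u0; have ds := is_derive_sincX d u0.
eapply is_derive_continuous; typeclasses eauto.
Qed.

Lemma sincX_cos_integrable (d : nat) (x : R) : (1 < d)%N ->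
  mu.-integrable D (EFin \o (fun u => sinc u ^+ d * cos (2 * x * u))).
Proof.
move=> d2; apply: (@le_pos_integrable _ _ (fun u => (1 + (2^-1 * u) ^+ 2)^-1)).
- by move=> u u0; exact: sincX_cos_continuous.
- by apply: integrable_cauchy; rewrite invr_gt0.
- by move=> u u0; apply: norm_sincXM_le => //; exact: cos_max.
Qed.

Lemma sincintN (d : nat) (x : R) : sincint d (- x) = sincint d x.
Proof. by apply: eq_Rintegral => u _; rewrite mulrN mulNr cosN. Qed.

(** This is the recurrence of the cardinal B-splines.  The difference of its two
sides is the integral of the derivative of s^n sin u cos (2xu), where s is
[sinc]: the derivative of s is (cos u - s) / u, and multiplying it by
sin u = s u clears the denominator. *)
Lemma sincint_rec (n : nat) (x : R) : (1 < n)%N ->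
  n%:R * sincint n.+1 x =
  (n.+1%:R / 2 - x) * sincint n (x - 2^-1) +
  (n.+1%:R / 2 + x) * sincint n (x + 2^-1).
Proof.
move=> n2; have n3 : (1 < n.+1)%N by rewrite ltnW.
pose f u := (n.+1%:R / 2 - x) * (sinc u ^+ n * cos (2 * (x - 2^-1) * u)) +
  (n.+1%:R / 2 + x) * (sinc u ^+ n * cos (2 * (x + 2^-1) * u)) -
  n%:R * (sinc u ^+ n.+1 * cos (2 * x * u)).
have intc y := sincX_cos_integrable y n2.
have intf : mu.-integrable D (EFin \o f).
  apply: pos_integrableB; first by apply: pos_integrableD; exact: pos_integrableZ.
  by apply: pos_integrableZ; exact: sincX_cos_integrable.
have : \int[mu]_(u in D) f u = 0.
  apply: (@Rintegral_derive_eq0 _ 1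
    (fun u => sinc u ^+ n * (sin u * cos (2 * x * u)))) => //.
  - move=> u u0; have ds := is_derive_sincX n u0.
    apply: is_derive_eq; rewrite /GRing.scale/= /f.
    have -> : 2 * (x - 2^-1) * u = 2 * x * u - u by field.
    have -> : 2 * (x + 2^-1) * u = 2 * x * u + u by field.
    rewrite cosB cosD.
    have sE : sin u = sinc u * u by rewrite /sinc divfK ?gt_eqF.
    have un0 : u != 0 by rewrite gt_eqF.
    case: (n) n2 => // m _; rewrite sE exprSr /=.
    rewrite -mulr_natl -!natr1 !exprS; field.
    by [].
  - move=> u u0; rewrite /f.
    have ds := is_derive_sincX n u0; have ds1 := is_derive_sincX n.+1 u0.
    eapply is_derive_continuous; typeclasses eauto.
  - move=> u u0; rewrite mul1r !normrM normrX.
    have s1 := norm_sinc_le1 u0; have c1 := cos_max (2 * x * u).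
    rewrite -[leRHS]mul1r ler_pM ?mulr_ge0 ?exprn_ge0 ?exprn_ile1//.
    rewrite -[leRHS]mulr1 ler_pM//.
    by rewrite (le_trans (norm_sin_le u))// gtr0_norm.
  - move=> u u0; rewrite div1r !normrM normrX.
    have s1 := norm_sinc_le1 u0; have c1 := cos_max (2 * x * u).
    apply: (@le_trans _ _ (`|sinc u|)).
      rewrite -[leRHS]mulr1 ler_pM ?mulr_ge0 ?exprn_ge0//.
        by rewrite ler_iXnr// ltnW.
      by rewrite -[leRHS]mulr1 ler_pM// sin_max.
    rewrite /sinc normrM normfV (gtr0_norm u0) -[leRHS]mul1r.
    by rewrite ler_wpM2r ?invr_ge0 ?(ltW u0)// sin_max.
rewrite RintegralB//; last 2 first.
- by apply: pos_integrableD; exact: pos_integrableZ.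
- by apply: pos_integrableZ; exact: sincX_cos_integrable.
rewrite RintegralD//; [|exact: pos_integrableZ..].
rewrite !RintegralZl//; last exact: sincX_cos_integrable.
by move/eqP; rewrite subr_eq0 => /eqP ->.
Qed.

End sinc_power_integral.

(** * The square of the cardinal sine *)

Section sinc_square_integral.
Context {R : realType}.
Local Notation mu := (@lebesgue_measure R).
Local Notation D := (`]0%R, +oo[%classic : set R).

Lemma cvg_pinfty_le_inv (C l : R) (f : R -> R) :
  (forall s, 0 < s -> `|f s - l| <= C / s) -> f s @[s --> +oo] --> l.
Proof.
move=> fC; apply/cvgrPdist_le => e e0; near=> s.
have s0 : 0 < s by near: s; exact: nbhs_pinfty_gt.
have sC : e^-1 * C <= s by near: s; apply: nbhs_pinfty_ge; exact: num_real.
by rewrite distrC (le_trans (fC _ s0))// ler_pdivrMr// -ler_pdivrMl.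
Unshelve. all: by end_near. Qed.

(** The rate C / u replaces the limit of [F] at infinity because all the
antiderivatives used below are bounded by an exponential times an affine
function, for which such a rate follows from lower bounds of [expR]. *)
Lemma ge0_integral_derive (C l : R) (F f : R -> R) :
  (forall u : R, is_derive u 1 F (f u)) -> continuous f ->
  (forall u, 0 <= u -> 0 <= f u) ->
  (forall u, 0 < u -> `|F u - l| <= C / u) ->
  (\int[mu]_(u in D) (f u)%:E = (l - F 0)%:E)%E.
Proof.
move=> dF cf f0 Fl.
rewrite integral_itv_obnd_cbnd; last first.
  by apply/measurable_EFinP; apply: pos_measurable => u _; exact: cf.
rewrite (@ge0_continuous_FTC2y _ _ F _ l)//.
- exact: continuous_subspaceT.
- exact: cvg_pinfty_le_inv Fl.
- by apply: cvg_at_right_filter; exact: is_derive_continuous (dF 0).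
- by move=> u _; rewrite derive1E; case: (dF u).
Qed.

Lemma integral_mulr_expN (u : R) : 0 < u ->
  (\int[mu]_(s in D) (s * expR (- (s * u)))%:E = (u ^- 2)%:E)%E.
Proof.
move=> u0; have un0 : u != 0 by rewrite gt_eqF.
have dF (s : R) : is_derive s 1 (fun s => - (s / u + u ^- 2) * expR (- (s * u)))
    (s * expR (- (s * u))).
  by apply: is_derive_eq; rewrite /GRing.scale/=; field.
rewrite (@ge0_integral_derive (4 / u ^+ 3) 0 _ _ dF).
- by congr EFin; rewrite !mul0r oppr0 expR0; ring.
- move=> s; eapply is_derive_continuous; typeclasses eauto.
- by move=> s s0; rewrite mulr_ge0// expR_ge0.
- move=> s s0; rewrite subr0 normrM normrN !ger0_norm ?expR_ge0//; last first.
    by rewrite addr_ge0 ?invr_ge0 ?divr_ge0// ltW// exprn_gt0.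
  have su0 : 0 < s * u by rewrite mulr_gt0.
  rewrite expRN ler_pdivrMr ?expR_gt0//.
  rewrite -(@ler_pM2l _ (u ^+ 2 * (s * u))); last by rewrite mulr_gt0// exprn_gt0.
  have -> : u ^+ 2 * (s * u) * (s / u + u ^- 2) = s * u + (s * u) ^+ 2.
    by field.
  have -> : u ^+ 2 * (s * u) * (4 / u ^+ 3 / s * expR (s * u)) = 4 * expR (s * u).
    by field; rewrite un0 gt_eqF.
  have := expR_ge1Dx (s * u); have := @expR_ge1Dxn _ (s * u) 1 (ltW su0).
  rewrite (_ : 2`!%:R = 2 :> R)//; set e := expR _; set x := s * u; nra.
Qed.

(** The Laplace transform of 1 - cos (bu) is 1/s - s / (s^2 + b^2); multiplied by
[s], it becomes a Cauchy function of [s]. *)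
Lemma integral_expN_one_sub_cos (b s : R) : 0 < b -> 0 < s ->
  (\int[mu]_(u in D) (s * expR (- (s * u)) * (1 - cos (b * u)))%:E
   = ((1 + (b^-1 * s) ^+ 2)^-1)%:E)%E.
Proof.
move=> b0 s0; have bn0 : b != 0 by rewrite gt_eqF.
have q0 : 0 < s ^+ 2 + b ^+ 2 by rewrite addr_gt0// exprn_gt0.
have qn0 : s ^+ 2 + b ^+ 2 != 0 by rewrite gt_eqF.
pose K := 1 + s ^+ 2 / (s ^+ 2 + b ^+ 2) + s * b / (s ^+ 2 + b ^+ 2).
have dF (u : R) : is_derive u 1 (fun u => expR (- (s * u)) *
      (-1 + s ^+ 2 / (s ^+ 2 + b ^+ 2) * cos (b * u)
       - s * b / (s ^+ 2 + b ^+ 2) * sin (b * u)))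
    (s * expR (- (s * u)) * (1 - cos (b * u))).
  by apply: is_derive_eq; rewrite /GRing.scale/=; field.
rewrite (@ge0_integral_derive (K / s) 0 _ _ dF).
- congr EFin; rewrite !mulr0 oppr0 expR0 cos0 sin0; field.
  by rewrite bn0 addrC qn0.
- move=> u; eapply is_derive_continuous; typeclasses eauto.
- by move=> u u0; rewrite !mulr_ge0 ?expR_ge0 ?subr_ge0 ?cos_le1// ltW.
- move=> u u0; rewrite subr0 normrM (ger0_norm (expR_ge0 _)) expRN.
  have su0 : 0 < s * u by rewrite mulr_gt0.
  have K0 : 0 <= K.
    by rewrite !addr_ge0 ?divr_ge0 ?mulr_ge0 ?sqr_ge0 ?(ltW s0) ?(ltW b0) ?(ltW q0).
  have -> : K / s / u = (s * u)^-1 * K by rewrite invfM [RHS]mulrC mulrA.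
  rewrite ler_pM ?invr_ge0 ?expR_ge0//.
    rewrite lef_pV2 ?posrE ?expR_gt0//.
    by apply: le_trans (expR_ge1Dx _); rewrite lerDr.
  rewrite /K.
  rewrite (le_trans (ler_normB _ _))// lerD//.
    rewrite (le_trans (ler_normD _ _))// normrN1 lerD// normrM.
    rewrite ger0_norm ?divr_ge0 ?(ltW q0) ?sqr_ge0//.
    by rewrite ler_piMr ?divr_ge0 ?(ltW q0) ?sqr_ge0// cos_max.
  rewrite normrM ger0_norm ?divr_ge0 ?(ltW q0) ?mulr_ge0 ?(ltW s0) ?(ltW b0)//.
  by rewrite ler_piMr ?sin_max// divr_ge0 ?(ltW q0) ?mulr_ge0 ?(ltW s0) ?(ltW b0).
Qed.

(** Write 1 / u^2 as the integral of s exp(- su) over s > 0 and exchange the two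
integrations; nonnegativity of 1 - cos is what makes Tonelli's theorem
applicable, whereas the integrand of [sincint] changes sign. *)
Lemma integral_one_sub_cos (b : R) : 0 < b ->
  (\int[mu]_(u in D) ((1 - cos (b * u)) / u ^+ 2)%:E = (pi / 2 * b)%:E)%E.
Proof.
move=> b0.
pose f (z : R * R) : \bar R :=
  ((fun z => (z.2 * expR (- (z.2 * z.1)) * (1 - cos (b * z.1)))%:E) \_ (D `*` D)) z.
have mf : measurable_fun setT f.
  apply/(measurable_restrictT _ _).1; first exact: measurableX.
  apply/measurable_EFinP/measurable_funTS.
  apply: measurable_funM.
    apply: measurable_funM => //.
    apply: (@measurableT_comp _ _ _ _ _ _ expR) => //.
    by apply: measurableT_comp => //; apply: measurable_funM.
  apply: measurable_funB => //.
  apply: (@measurableT_comp _ _ _ _ _ _ cos) => //.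
    by apply: continuous_measurable_fun; exact: continuous_cos.
  exact: measurable_funM.
have Dp u : D u -> 0 < u by rewrite /= in_itv/= andbT.
have f0 z : (0 <= f z)%E.
  rewrite /f patchE; case: ifPn => //; rewrite inE => -[/= /Dp z1 /Dp z2].
  by rewrite lee_fin !mulr_ge0 ?expR_ge0 ?subr_ge0 ?cos_le1// ltW.
have := @fubini_tonelli _ _ _ _ _ mu mu f mf f0.
have -> : (\int[mu]_x \int[mu]_y f (x, y) =
    \int[mu]_(u in D) ((1 - cos (b * u)) / u ^+ 2)%:E)%E.
  rewrite [RHS]integral_mkcond; apply: eq_integral => u _.
  rewrite patchE; case: ifPn => [uD|uD]; last first.
    apply: integral0_eq => s _; rewrite /f patchE memNset// => -[/=].
    by move=> uD' _; rewrite mem_set in uD.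
  rewrite inE in uD.
  transitivity (\int[mu]_(s in D) ((1 - cos (b * u))%:E * (s * expR (- (s * u)))%:E))%E.
    rewrite [RHS]integral_mkcond; apply: eq_integral => s _.
    rewrite /f !patchE in_setX/= mem_set//=; case: ifPn => // _.
    by rewrite -EFinM mulrC.
  rewrite ge0_integralZl//.
  - by rewrite integral_mulr_expN ?Dp// -EFinM.
  - apply/measurable_EFinP; apply: pos_measurable => s _.
    eapply is_derive_continuous; typeclasses eauto.
  - by move=> s /Dp s0; rewrite lee_fin mulr_ge0 ?expR_ge0// ltW.
move=> ->.
have -> : (pi / 2 * b = pi / 2 / b^-1) by rewrite invrK.
rewrite -integral_cauchy ?invr_gt0//.
rewrite [RHS]integral_mkcond; apply: eq_integral => s _.
rewrite patchE; case: ifPn => [sD|sD]; last first.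
  apply: integral0_eq => u _; rewrite /f patchE memNset// => -[/=].
  by move=> _ sD'; rewrite mem_set in sD.
rewrite inE in sD.
rewrite -(integral_expN_one_sub_cos b0 (Dp _ sD)).
rewrite [RHS]integral_mkcond; apply: eq_integral => u _.
by rewrite /f !patchE in_setX/= (mem_set sD)/= andbT.
Qed.

Lemma one_sub_cos_integrable (b : R) :
  mu.-integrable D (EFin \o (fun u => (1 - cos (b * u)) / u ^+ 2)).
Proof.
wlog b0 : b / 0 <= b.
  move=> H; have [|b0] := leP 0 b; first exact: H.
  have := H (- b); rewrite oppr_ge0 ltW// => /(_ isT).
  by apply: eq_integrable => // u _ /=; rewrite mulNr cosN.
move: b0; rewrite le_eqVlt => /predU1P[<-|b0].
  apply: (eq_integrable _ (cst 0%E)) => //; last exact: integrable0.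
  by move=> u _ /=; rewrite mul0r cos0 subrr mul0r.
apply/integrableP; split.
  apply/measurable_EFinP; apply: pos_measurable => u u0.
  apply: cvgM.
    have dc : is_derive u 1 (fun u => 1 - cos (b * u)) (b * sin (b * u)).
      by apply: is_derive_eq; rewrite /GRing.scale/=; ring.
    exact: (is_derive_continuous dc).
  apply: cvgV; first by rewrite expf_neq0// gt_eqF.
  exact: exprn_continuous.
under eq_integral do rewrite /= ger0_norm ?divr_ge0 ?sqr_ge0 ?subr_ge0 ?cos_le1//.
by rewrite integral_one_sub_cos// ltry.
Qed.

Lemma Rintegral_one_sub_cos (b : R) :
  \int[mu]_(u in D) ((1 - cos (b * u)) / u ^+ 2) = pi / 2 * `|b|.
Proof.
wlog b0 : b / 0 <= b.
  move=> H; have [|b0] := leP 0 b; first exact: H.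
  rewrite -normrN -H; last by rewrite oppr_ge0 ltW.
  by apply: eq_Rintegral => u _; rewrite mulNr cosN.
move: b0; rewrite le_eqVlt => /predU1P[<-|b0]; last first.
  by rewrite gtr0_norm// /Rintegral integral_one_sub_cos.
rewrite normr0 mulr0 (@eq_Rintegral _ _ _ mu D (cst 0)).
  by rewrite /Rintegral integral0.
by move=> u _ /=; rewrite mul0r cos0 subrr mul0r.
Qed.

(** The product sin^2 u cos (2xu) is a second difference in [x] of
1 - cos (2xu), so the integral is the second difference of the absolute value:
a hat function that vanishes at all nonzero integers. *)
Lemma sincint2 (x : R) :
  sincint 2 x = pi / 4 * (`|x + 1| + `|x - 1| - 2 * `|x|).
Proof.
pose g b u : R := (1 - cos (b * u)) / u ^+ 2.
have Ig b : mu.-integrable D (EFin \o g b) := one_sub_cos_integrable b.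
transitivity (\int[mu]_(u in D)
    (4^-1 * (g (2 * (x + 1)) u + g (2 * (x - 1)) u - 2 * g (2 * x) u))).
  apply: eq_Rintegral => u; rewrite inE/= in_itv/= andbT => u0.
  have -> : sinc u ^+ 2 * cos (2 * x * u) = sin u ^+ 2 * cos (2 * x * u) / u ^+ 2.
    by rewrite /sinc expr_div_n mulrAC.
  have -> : sin u ^+ 2 * cos (2 * x * u) = 4^-1 * ((1 - cos (2 * (x + 1) * u))
      + (1 - cos (2 * (x - 1) * u)) - 2 * (1 - cos (2 * x * u))).
    have -> : 2 * (x + 1) * u = 2 * x * u + u *+ 2 by rewrite -mulr_natl; ring.
    have -> : 2 * (x - 1) * u = 2 * x * u - u *+ 2 by rewrite -mulr_natl; ring.
    by rewrite cosB cosD cos_mulr2n -mulr_natl cos2sin2; field.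
  by rewrite /g; field; rewrite gt_eqF.
rewrite RintegralZl//; last first.
  by apply: pos_integrableB; [exact: pos_integrableD|exact: pos_integrableZ].
rewrite RintegralB ?RintegralD ?RintegralZl//;
  [|exact: pos_integrableD|exact: pos_integrableZ].
rewrite !Rintegral_one_sub_cos !(normrM 2) (ger0_norm (ler0n _ 2)).
by field.
Qed.

End sinc_square_integral.

(** * Eulerian numbers as integrals *)

Lemma eulerian0 (d : nat) : eulerian d 0 = 0%N.
Proof. by case: d. Qed.

Lemma eulerian_large (d i : nat) : (d <= i)%N -> eulerian d i = 0%N.
Proof. by case: d => [|d] // di; rewrite /= (ltnNge i) di andbF. Qed.

(** With the value 0 outside of the range 1 <= i <= d - 1, the boundary values 1
obey the same recurrence as the others; truncated subtraction is harmless
because it multiplies an Eulerian number that vanishes. *)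
Lemma eulerianSS (n i : nat) : (1 < n)%N ->
  eulerian n.+1 i.+1 = ((n - i) * eulerian n i + i.+1 * eulerian n i.+1)%N.
Proof.
move=> n2; have [ni|ni] := leqP n i.
  rewrite (@eulerian_large n.+1)// (@eulerian_large n i)//.
  by rewrite (@eulerian_large n i.+1) ?muln0// ltnW.
have [->|i0] := eqVneq i 0%N.
  by rewrite eulerian0 muln0 mul1n !eulerian_first// ltnW.
have [iE|iE] := eqVneq i.+1 n.
  rewrite -iE (@eulerian_large i.+1 i.+1)// muln0 addn0 subSnn mul1n.
  have e1 : eulerian i.+2 i.+1 = 1%N by exact: (@eulerian_last i.+2).
  have e2 : eulerian i.+1 i = 1%N by apply: (@eulerian_last i.+1); rewrite iE.
  by rewrite e1 e2.
rewrite eulerian_rec ?ltnS ?lt0n//; first by rewrite !subn1 subSS.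
by rewrite subSS subn1 -ltnS prednK ?(ltnW n2)// ltn_neqAle iE.
Qed.

Section eulerian_integral.
Context {R : realType}.

(** Allowing every natural [i], including those where both sides vanish, lets the
induction on [d] go through.  The value at i = 0 of row d + 1 calls for the
integral at -1 - d/2, which parity turns into the one at (d + 1) - d/2. *)
Lemma sincint_eulerian (d i : nat) : (1 < d)%N ->
  sincint d (i%:R - d%:R / 2) = pi / 2 * (eulerian d i)%:R / (d.-1)`!%:R :> R.
Proof.
elim: d i => [//|[//|n] IH] i _.
case: n IH => [_|n /(_ _ isT) IH].
  rewrite divff ?pnatr_eq0// sincint2 divr1.
  case: i => [|[|i]].
  - by rewrite sub0r addNr normr0 -opprD !normrN normr1 ger0_norm// eulerian0; field.
  - by rewrite subrr add0r sub0r normr0 normrN normr1 eulerian_first//; field.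
  - rewrite eulerian_large// -(addn2 i) natrD.
    have i0 : 0 <= i%:R :> R by [].
    by rewrite !ger0_norm; lra.
have : (1 < n.+2)%N by [].
move: n.+2 IH => m IH m2.
have mn0 : m%:R != 0 :> R by rewrite pnatr_eq0 -lt0n ltnW.
apply: (mulfI mn0); rewrite sincint_rec//.
have -> : (m.+1%:R / 2 - (i%:R - m.+1%:R / 2)) = m%:R + 1 - i%:R :> R.
  by rewrite -natr1; field.
have -> : m.+1%:R / 2 + (i%:R - m.+1%:R / 2) = i%:R :> R by ring.
have -> : i%:R - m.+1%:R / 2 + 2^-1 = i%:R - m%:R / 2 :> R.
  by rewrite -natr1; field.
have fE : m`!%:R = m%:R * (m.-1)`!%:R :> R.
  by rewrite -natrM -[in LHS](prednK (ltnW m2)) factS prednK// ltnW.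
have f0 : (m.-1)`!%:R != 0 :> R by rewrite pnatr_eq0 -lt0n fact_gt0.
rewrite IH; case: i => [|i].
  rewrite -sincintN.
  have -> : - (0 - m.+1%:R / 2 - 2^-1) = m.+1%:R - m%:R / 2 :> R.
    by rewrite -natr1; field.
  by rewrite IH eulerian_large// !eulerian0; ring.
have -> : i.+1%:R - m.+1%:R / 2 - 2^-1 = i%:R - m%:R / 2 :> R.
  by rewrite -!natr1; field.
rewrite IH eulerianSS// succnK fE natrD !natrM.
have -> : (m - i)%:R * (eulerian m i)%:R = (m%:R - i%:R) * (eulerian m i)%:R :> R.
  have [mi|mi] := leqP m i; first by rewrite eulerian_large// !mulr0.
  by rewrite natrB// ltnW.
rewrite -natr1; move: (m.-1)`!%:R f0 => f f0; field.
by rewrite f0 mn0.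
Qed.

End eulerian_integral.

(** * The cosine transform of a Gaussian *)

Section gauss_cosine_integral.
Context {R : realType}.
Local Notation mu := (@lebesgue_measure R).
Local Notation D := (`]0%R, +oo[%classic : set R).
Variable r : R.
Hypothesis r0 : 0 < r.

Definition gaussint (x : R) :=
  \int[mu]_(u in D) (expR (- (r * u) ^+ 2) * cos (2 * x * u)).

Lemma gauss_le_cauchy (u : R) : expR (- (r * u) ^+ 2) <= (1 + (r * u) ^+ 2)^-1.
Proof.
rewrite expRN lef_pV2 ?posrE ?expR_gt0//; first exact: expR_ge1Dx.
by rewrite ltr_pwDl// sqr_ge0.
Qed.

(** This dominates the derivative of the integrand of [gaussint] in the parameter.
With y = ru, it reduces to 2 y (1 + y^2) <= (1 + y^2)^2 <= 4 exp(y^2). *)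
Lemma mulr_gauss_le_cauchy (u : R) : 0 < u ->
  u * expR (- (r * u) ^+ 2) <= 2 / r * (1 + (r * u) ^+ 2)^-1.
Proof.
move=> u0; rewrite expRN ler_pdivrMr ?expR_gt0// mulrAC ler_pdivlMr; last first.
  by rewrite ltr_pwDl// sqr_ge0.
rewrite mulrAC ler_pdivlMr//.
have := expR_ge1Dx ((r * u) ^+ 2); have := @expR_ge1Dxn _ ((r * u) ^+ 2) 1 (sqr_ge0 _).
have : 0 <= (1 - r * u) ^+ 2 by rewrite sqr_ge0.
have : 0 < r * u by rewrite mulr_gt0.
rewrite (_ : 2`!%:R = 2 :> R)//.
have -> : u * (1 + (r * u) ^+ 2) * r = (r * u) * (1 + (r * u) ^+ 2) by ring.
set e := expR _; set x := r * u => x0 x1 e2 e1.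
apply: (@le_trans _ _ ((1 + x ^+ 2) ^+ 2 / 2)); last by lra.
have xx : x <= (1 + x ^+ 2) / 2 by lra.
have p0 : 0 <= 1 + x ^+ 2 by rewrite addr_ge0 ?sqr_ge0.
by have := ler_wpM2r p0 xx; lra.
Qed.

Lemma gauss_cos_integrable (x : R) :
  mu.-integrable D (EFin \o (fun u => expR (- (r * u) ^+ 2) * cos (2 * x * u))).
Proof.
apply: le_pos_integrable (integrable_cauchy r0) _ => u u0.
  eapply is_derive_continuous; typeclasses eauto.
rewrite normrM (ger0_norm (expR_ge0 _)) -[leRHS]mulr1.
by rewrite ler_pM// ?expR_ge0 ?cos_max// gauss_le_cauchy.
Qed.

Lemma gauss_sin_integrable (x : R) : mu.-integrable D
  (EFin \o (fun u => 2 * (u * expR (- (r * u) ^+ 2)) * sin (2 * x * u))).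
Proof.
apply: (@le_pos_integrable _ _ (fun u => 4 / r * (1 + (r * u) ^+ 2)^-1)).
- move=> u u0; eapply is_derive_continuous; typeclasses eauto.
- exact/pos_integrableZ/integrable_cauchy.
move=> u u0; rewrite normrM -[leRHS]mulr1 ler_pM ?sin_max//.
rewrite ger0_norm ?mulr_ge0 ?expR_ge0 ?(ltW u0)//.
have := mulr_gauss_le_cauchy u0; lra.
Qed.

(** Integration by parts: exp(- (ru)^2) sin (2xu) vanishes at 0 and at infinity. *)
Lemma gauss_sin_cos (x : R) :
  r ^+ 2 * \int[mu]_(u in D) (2 * (u * expR (- (r * u) ^+ 2)) * sin (2 * x * u))
  = 2 * x * gaussint x.
Proof.
apply/eqP; rewrite -subr_eq0 -!RintegralZl//;
  [|exact: gauss_cos_integrable|exact: gauss_sin_integrable].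
rewrite -RintegralB//; [|exact/pos_integrableZ/gauss_sin_integrable
  |exact/pos_integrableZ/gauss_cos_integrable].
apply/eqP.
(* The first summand bounds the slope at 0, the second one the decay. *)
pose C := 2 * `|x| + r^-1.
have C0 : 0 <= C by rewrite addr_ge0 ?mulr_ge0 ?invr_ge0 ?(ltW r0).
apply: (@Rintegral_derive_eq0 _ C
  (fun u => - (expR (- (r * u) ^+ 2) * sin (2 * x * u)))).
- by move=> u u0; apply: is_derive_eq; rewrite /GRing.scale/=; ring.
- move=> u u0; eapply is_derive_continuous; typeclasses eauto.
- apply: pos_integrableB; first exact/pos_integrableZ/gauss_sin_integrable.
  exact/pos_integrableZ/gauss_cos_integrable.
- move=> u u0; rewrite normrN normrM (ger0_norm (expR_ge0 _)).
  apply: (@le_trans _ _ (1 * (2 * `|x| * u))).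
    rewrite ler_pM ?expR_ge0//.
      by rewrite -expR0 ler_expR oppr_le0 sqr_ge0.
    have -> : 2 * `|x| * u = `|2 * x * u|.
      by rewrite !normrM (gtr0_norm u0) (ger0_norm (ler0n _ 2)).
    exact: norm_sin_le.
  by rewrite mul1r ler_wpM2r ?(ltW u0)// /C lerDl invr_ge0 ltW.
- move=> u u0; rewrite normrN normrM (ger0_norm (expR_ge0 _)).
  apply: (@le_trans _ _ (r^-1 / u * 1)).
    rewrite ler_pM ?expR_ge0 ?sin_max//.
    rewrite (le_trans (gauss_le_cauchy u))// -invfM lef_pV2 ?posrE ?mulr_gt0//.
      have : 0 <= (1 - r * u) ^+ 2 by rewrite sqr_ge0.
      have : 0 < r * u by rewrite mulr_gt0.
      move: (r * u) => y; lra.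
    by rewrite ltr_pwDl// sqr_ge0.
  by rewrite mulr1 ler_wpM2r ?invr_ge0 ?(ltW u0)// /C lerDr mulr_ge0.
Qed.

(** Differentiating under the integral sign produces the sine integral of
[gauss_sin_cos], hence a linear differential equation that determines
[gaussint] from its value at 0. *)
Lemma is_derive_gaussint (x : R) :
  is_derive x 1 gaussint (- (2 * x / r ^+ 2) * gaussint x).
Proof.
pose f (x u : R) := expR (- (r * u) ^+ 2) * cos (2 * x * u).
have df (y u : R) : is_derive y 1 (f ^~ u)
    (- (2 * (u * expR (- (r * u) ^+ 2)) * sin (2 * y * u))).
  by apply: is_derive_eq; rewrite /GRing.scale/=; ring.
have dfE (y u : R) : partial1of2 f y u =
    - (2 * (u * expR (- (r * u) ^+ 2)) * sin (2 * y * u)).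
  by rewrite partial1of2E; case: (df y u).
pose G (u : R) := 4 / r * (1 + (r * u) ^+ 2)^-1.
have G0 u : 0 <= G u.
  by rewrite mulr_ge0 ?divr_ge0 ?invr_ge0 ?addr_ge0 ?sqr_ge0// ltW.
have IG : mu.-integrable D (EFin \o G).
  exact/pos_integrableZ/integrable_cauchy.
have xI : `]x - 1, x + 1[%classic x.
  by rewrite /= in_itv/= ltrDl ltrBlDr ltrDl ltr01.
have If y : `]x - 1, x + 1[%classic y -> mu.-integrable D (EFin \o f y).
  by move=> _; exact: gauss_cos_integrable.
have Df y u : `]x - 1, x + 1[%classic y -> D u -> derivable (f ^~ u) y 1.
  by move=> _ _; case: (df y u).
have GD y u : `]x - 1, x + 1[%classic y -> D u -> `|partial1of2 f y u| <= G u.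
  move=> _; rewrite /= in_itv/= andbT => u0.
  rewrite dfE normrN normrM -[leRHS]mulr1 ler_pM ?sin_max//.
  rewrite ger0_norm ?mulr_ge0 ?expR_ge0 ?(ltW u0)//.
  have := mulr_gauss_le_cauchy u0; rewrite /G; lra.
have mD : measurable (D : set (measurableTypeR R)) by exact: measurable_itv.
apply: DeriveDef.
  exact: (derivable_under_integral mD xI If Df G0 IG GD).
rewrite -derive1E (differentiation_under_integral mD xI If Df G0 IG GD).
transitivity (- 1 * \int[mu]_(u in D)
    (2 * (u * expR (- (r * u) ^+ 2)) * sin (2 * x * u))).
  rewrite -RintegralZl//; last exact: gauss_sin_integrable.
  by apply: eq_Rintegral => u _; rewrite dfE mulN1r.
have rn0 : r != 0 by rewrite gt_eqF.
have := gauss_sin_cos x; set A := \int[mu]_(u in _) _ => AE.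
have -> : A = r ^- 2 * (r ^+ 2 * A) by field.
by rewrite AE; field.
Qed.

Lemma gaussint0 : gaussint 0 = Num.sqrt pi / (2 * r).
Proof.
have rn0 : r != 0 by rewrite gt_eqF.
have dr (u : R) : is_derive u 1 (fun u => r * u) r.
  by apply: is_derive_eq; rewrite /GRing.scale/= mulr1.
have drE : derive1 (fun u : R => r * u) = cst r.
  by apply/funext => u; rewrite derive1E; case: (dr u).
have : (\int[mu]_(u in `[(r * 0)%R, +oo[) (gauss_fun u)%:E =
    \int[mu]_(u in `[0%R, +oo[)
      (((gauss_fun \o (fun u => r * u)) * derive1 (fun u : R => r * u)) u)%:E)%E.
  apply: increasing_ge0_integration_by_substitutiony.
  - by move=> u v _ _ uv; rewrite ltr_pM2l.
  - by rewrite drE => u _; exact: cvg_cst.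
  - by rewrite drE; exact: is_cvg_cst.
  - by rewrite drE; exact: is_cvg_cst.
  - split; first by move=> u _; case: (dr u).
    by apply: cvg_at_right_filter; exact: is_derive_continuous (dr 0).
  - exact: gt0_cvgMry.
  - by apply: continuous_subspaceT; exact: continuous_gauss_fun.
  - by move=> u _; exact: gauss_fun_ge0.
rewrite mulr0 integral0y_gauss drE => gE.
have {}gE : (\int[mu]_(u in D) (r * gauss_fun (r * u))%:E = (Num.sqrt pi / 2)%:E)%E.
  rewrite gE integral_itv_obnd_cbnd; last first.
    apply/measurable_EFinP; apply: pos_measurable => u u0.
    rewrite /gauss_fun; eapply is_derive_continuous; typeclasses eauto.
  by apply: eq_integral => u _; rewrite mulrC.
have : \int[mu]_(u in D) (r * (expR (- (r * u) ^+ 2) * cos (2 * 0 * u)))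
    = Num.sqrt pi / 2.
  rewrite -[RHS]/(fine (Num.sqrt pi / 2)%:E) -gE.
  by apply: eq_Rintegral => u _; rewrite mulr0 mul0r cos0 mulr1.
rewrite RintegralZl//; last exact: gauss_cos_integrable.
rewrite -/(gaussint 0) => h.
apply: (mulfI rn0); rewrite h; field.
by rewrite rn0.
Qed.

Lemma gaussintE (x : R) :
  gaussint x = Num.sqrt pi / (2 * r) * expR (- (x / r) ^+ 2).
Proof.
have rn0 : r != 0 by rewrite gt_eqF.
(* Multiplied by the inverse of the expected solution, [gaussint] is constant. *)
have cst0 : gaussint x * expR ((x / r) ^+ 2) = gaussint 0 * expR ((0 / r) ^+ 2).
  apply: (@is_derive_0_is_cst _ (fun x => gaussint x * expR ((x / r) ^+ 2))) => y.
  have dg := is_derive_gaussint y.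
  by apply: is_derive_eq; rewrite /GRing.scale/=; field.
rewrite mul0r expr0n/= expR0 mulr1 gaussint0 in cst0.
by rewrite -cst0 -mulrA -expRD addrN expR0 mulr1.
Qed.

End gauss_cosine_integral.

(** * Comparison of the two transforms *)

Section local_limit.
Context {R : realType}.
Local Notation mu := (@lebesgue_measure R).
Local Notation D := (`]0%R, +oo[%classic : set R).

Lemma ler_normB_exprn (n : nat) (a b m : R) : `|a| <= m -> `|b| <= m ->
  `|a ^+ n.+1 - b ^+ n.+1| <= n.+1%:R * (`|a - b| * m ^+ n).
Proof.
move=> am bm; rewrite subrXX normrM mulrCA ler_wpM2l//.
rewrite (le_trans (ler_norm_sum _ _ _))//.
have m0 : 0 <= m := le_trans (normr_ge0 a) am.
rewrite mulr_natl -[X in _ *+ X]card_ord -sumr_const.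
apply: ler_sum => i _.
rewrite normrM !normrX -[leRHS](_ : m ^+ (n.+1.-1 - i) * m ^+ i = _); last first.
  by rewrite -exprD subnK// -ltnS.
by rewrite ler_pM ?exprn_ge0// lerXn2r ?nnegrE.
Qed.

Lemma bernoulli_ge (n : nat) (z : R) : 0 <= z -> 1 + n%:R * z <= (1 + z) ^+ n.
Proof.
move=> z0; elim: n => [|n IH]; first by rewrite mul0r addr0 expr0.
rewrite exprSr -natr1.
have z1 : 0 <= 1 + z by rewrite addr_ge0.
apply: le_trans (ler_wpM2r z1 IH).
have : 0 <= n%:R * z * z by rewrite !mulr_ge0.
lra.
Qed.

(** The factor u^4 of the telescoped difference must be absorbed by the (d - 1)-th
power of the common majorant.  As d - 1 >= 6q, that power is at most
(1 + u^2/4)^(- 3q) <= (1 + q u^2/4)^(- 3); two of these three factors absorb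
u^4 at the price of 16 / q^2, and the third one is integrable. *)
Lemma sincX_gauss_dist (d q : nat) (u : R) : (6 * q < d)%N -> (0 < q)%N -> 0 < u ->
  `|sinc u ^+ d - expR (- (u ^+ 2 / 6)) ^+ d| <=
  16 * d%:R / q%:R ^+ 2 * (1 + (Num.sqrt q%:R / 2 * u) ^+ 2)^-1.
Proof.
case: d => // n; rewrite ltnS => qn q0 u0.
have u2 : 0 <= u ^+ 2 by rewrite sqr_ge0.
pose B := (1 + u ^+ 2 / 4)^-1.
have b1 : 0 <= 1 + u ^+ 2 / 4 by lra.
have B0 : 0 < B by rewrite invr_gt0; lra.
have B1 : B <= 1 by rewrite invf_le1; lra.
have sB (a : R) : a ^+ 2 <= B -> `|a| <= Num.sqrt B.
  by move=> aB; rewrite -sqrtr_sqr ler_wsqrtr.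
have s1 := sB _ (sinc_sqr_le u0).
have g1 : `|expR (- (u ^+ 2 / 6))| <= Num.sqrt B.
  apply: sB; rewrite -expRM_natl mulrN expRN lef_pV2 ?posrE ?expR_gt0//; last by lra.
  have := expR_ge1Dx (u ^+ 2 / 6 * 2).
  rewrite mulrC; lra.
apply: (le_trans (ler_normB_exprn n s1 g1)).
rewrite [leRHS](_ : _ =
  n.+1%:R * (16 / q%:R ^+ 2 / (1 + (Num.sqrt q%:R / 2 * u) ^+ 2))); last by ring.
rewrite ler_wpM2l//.
have q1 : 0 < q%:R :> R by rewrite ltr0n.
pose z := q%:R * (u ^+ 2 / 4).
have z0 : 0 <= z by rewrite mulr_ge0 ?divr_ge0// ltW.
have z1 : 0 <= 1 + z by lra.
have -> : (Num.sqrt q%:R / 2 * u) ^+ 2 = z.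
  by rewrite exprMn expr_div_n sqr_sqrtr ?(ltW q1)// /z; field.
(* Bernoulli's inequality on the q-th power of 1 + u^2/4. *)
have Bz : Num.sqrt B ^+ n <= (1 + z) ^- 3.
  apply: (@le_trans _ _ (Num.sqrt B ^+ (6 * q))).
    rewrite ler_wiXn2l ?sqrtr_ge0//.
    by rewrite -sqrtr1 ler_wsqrtr.
  rewrite (_ : (6 * q = 2 * (q * 3))%N); last by rewrite mulnCA mulnC.
  rewrite exprM sqr_sqrtr ?(ltW B0)// exprM -exprVn.
  rewrite lerXn2r ?nnegrE ?exprn_ge0 ?invr_ge0 ?(ltW B0)//.
  rewrite /B exprVn lef_pV2 ?posrE ?exprn_gt0//; [|lra|lra].
  by apply: bernoulli_ge; rewrite divr_ge0.
have uz : u ^+ 4 <= 16 / q%:R ^+ 2 * (1 + z) ^+ 2.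
  have -> : u ^+ 4 = 16 / q%:R ^+ 2 * z ^+ 2.
    by rewrite /z; field; rewrite gt_eqF.
  rewrite ler_wpM2l ?divr_ge0 ?sqr_ge0//.
  by rewrite lerXn2r ?nnegrE; lra.
have -> : 16 / q%:R ^+ 2 / (1 + z) = 16 / q%:R ^+ 2 * (1 + z) ^+ 2 * (1 + z) ^- 3.
  have zn0 : 1 + z != 0 by rewrite gt_eqF//; lra.
  by field; rewrite ?zn0 ?(gt_eqF q1).
rewrite ler_pM ?exprn_ge0 ?sqrtr_ge0//.
exact: le_trans (sinc_gauss_dist u0) uz.
Qed.

Lemma sincint_gaussint_dist (d q : nat) (x : R) : (6 * q < d)%N -> (0 < q)%N ->
  `|sincint d x - gaussint (Num.sqrt (d%:R / 6)) x| <=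
  16 * pi * d%:R / (q%:R ^+ 2 * Num.sqrt q%:R).
Proof.
move=> qd q0.
have d0 : 0 < d%:R :> R by rewrite ltr0n (leq_ltn_trans _ qd).
have d1 : (1 < d)%N.
  by apply: leq_ltn_trans qd; rewrite muln_gt0.
have q1 : 0 < q%:R :> R by rewrite ltr0n.
have sq0 : 0 < Num.sqrt q%:R :> R by rewrite sqrtr_gt0.
have r0 : 0 < Num.sqrt (d%:R / 6) :> R by rewrite sqrtr_gt0 divr_gt0.
set r := Num.sqrt (d%:R / 6) in r0 *.
have Is := sincX_cos_integrable x d1; have Ig := gauss_cos_integrable r0 x.
rewrite /sincint /gaussint -RintegralB//.
have IB := pos_integrableB Is Ig.
apply: (le_trans (le_normr_Rintegral _ IB)) => //.
have h0 : 0 < Num.sqrt q%:R / 2 :> R by rewrite divr_gt0.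
have IC := pos_integrableZ (16 * d%:R / q%:R ^+ 2) (integrable_cauchy h0).
apply: (@le_trans _ _ (\int[mu]_(u in D)
    (16 * d%:R / q%:R ^+ 2 * (1 + (Num.sqrt q%:R / 2 * u) ^+ 2)^-1))).
  apply: le_Rintegral => //; first exact: integrable_norm.
  move=> u; rewrite /= in_itv/= andbT => u0.
  have -> : expR (- (r * u) ^+ 2) = expR (- (u ^+ 2 / 6)) ^+ d.
    by rewrite -expRM_natl exprMn sqr_sqrtr ?divr_ge0//; congr expR; field.
  rewrite -mulrBl normrM -[leRHS]mulr1 ler_pM ?cos_max//.
  exact: sincX_gauss_dist.
rewrite RintegralZl//; last exact: integrable_cauchy.
rewrite /Rintegral integral_cauchy//=.
rewrite le_eqVlt; apply/orP; left; apply/eqP; field.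
by rewrite !gt_eqF.
Qed.

End local_limit.

(** * Local limit for Eulerian numbers *)

Section eulerian_limit.
Context {R : realType}.

(** The derivative is bounded by sqrt 6 because
exp(6 c^2) >= 1 + 6 c^2 >= 2 sqrt 6 |c|, by the arithmetic-geometric mean
inequality. *)
Lemma gauss6_lipschitz (a b : R) :
  `|expR (- (6 * a ^+ 2)) - expR (- (6 * b ^+ 2))| <= Num.sqrt 6 * `|a - b|.
Proof.
wlog ba : a b / b <= a.
  move=> H; have [|/ltW ab] := leP b a; first exact: H.
  by rewrite distrC (distrC a); exact: H.
pose f (x : R) := expR (- (6 * x ^+ 2)).
have df (x : R) : is_derive x 1 f (- (12 * x) * f x).
  by apply: is_derive_eq; rewrite /GRing.scale/= /f; ring.
have cf : {within `[b, a], continuous f}.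
  by apply: derivable_within_continuous => x _; case: (df x).
have [c _ ->] := MVT_segment ba (fun x _ => df x) cf.
rewrite normrM ler_wpM2r// normrM normrN (ger0_norm (expR_ge0 _)).
rewrite expRN ler_pdivrMr ?expR_gt0//.
have s0 : 0 < Num.sqrt 6 :> R by rewrite sqrtr_gt0.
have s6 : Num.sqrt 6 ^+ 2 = 6 :> R by rewrite sqr_sqrtr.
rewrite -(@ler_pM2l _ (Num.sqrt 6))// mulrA -expr2 s6.
apply: (@le_trans _ _ (6 * (1 + 6 * c ^+ 2))); last first.
  by rewrite ler_wpM2l// expR_ge1Dx.
rewrite normrM (ger0_norm (ler0n _ 12)) -[c ^+ 2]real_normK ?num_real//.
move: (Num.sqrt 6) s6 `|c| => s s6 y.
have : 0 <= (s * y - 1) ^+ 2 by rewrite sqr_ge0.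
have -> : (s * y - 1) ^+ 2 = s ^+ 2 * y ^+ 2 - 2 * (s * y) + 1 by ring.
rewrite s6; lra.
Qed.

(** Take q = d / 12 rounded down in [sincint_gaussint_dist]; then d <= 25 q, so
that d^2 / q^2 <= 25^2 and sqrt (d / q) <= 5. *)
Lemma eulerian_gauss_dist (d i : nat) : (12 <= d)%N ->
  `|Num.sqrt d%:R / (d.-1)`!%:R * (eulerian d i)%:R
    - Num.sqrt (6 / pi) * expR (- (6 * ((i%:R - d%:R / 2) / Num.sqrt d%:R) ^+ 2))|
  <= 32 * 25 ^+ 2 * 5 / d%:R :> R.
Proof.
move=> d12; have d2 : (1 < d)%N by apply: leq_trans d12.
have d0 : 0 < d%:R :> R by rewrite ltr0n ltnW.
have p0 : 0 < pi :> R := pi_gt0 R.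
have pn0 : pi != 0 :> R by rewrite gt_eqF.
pose q := (d %/ 12)%N.
have q0 : (0 < q)%N by rewrite divn_gt0.
have qd : (6 * q < d)%N.
  have : (q * 12 <= d)%N := leq_divM d 12.
  by apply: leq_trans; rewrite mulnC ltn_pmul2l.
have dq : (d <= 25 * q)%N.
  have := ltn_ceil d (isT : 0 < 12)%N; rewrite -/q mulSn => /ltnW h.
  apply: (leq_trans h); rewrite (_ : 25 = 13 + 12)%N// mulnDl (mulnC q) leq_add2r.
  by rewrite (leq_trans _ (leq_pmulr 13 q0)).
have q1 : 0 < q%:R :> R by rewrite ltr0n.
set x : R := i%:R - d%:R / 2.
set sd : R := Num.sqrt d%:R.
have sd0 : 0 < sd by rewrite sqrtr_gt0.
have sdE : sd ^+ 2 = d%:R by rewrite sqr_sqrtr// ltW.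
have f0 : (d.-1)`!%:R != 0 :> R by rewrite pnatr_eq0 -lt0n fact_gt0.
have -> : sd / (d.-1)`!%:R * (eulerian d i)%:R = sd * (2 / pi) * sincint d x.
  rewrite sincint_eulerian//; clear p0.
  by move: (d.-1)`!%:R f0 pi pn0 => f f0 p pn0; field; rewrite f0 pn0.
have r0 : 0 < Num.sqrt (d%:R / 6) :> R by rewrite sqrtr_gt0 divr_gt0.
have -> : Num.sqrt (6 / pi) * expR (- (6 * (x / sd) ^+ 2)) =
    sd * (2 / pi) * gaussint (Num.sqrt (d%:R / 6)) x.
  rewrite gaussintE// !expr_div_n sdE sqr_sqrtr ?divr_ge0//.
  have -> : 6 * (x ^+ 2 / d%:R) = x ^+ 2 / (d%:R / 6).
    by field; rewrite gt_eqF.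
  rewrite mulrA; congr (_ * _).
  rewrite !sqrtrM ?(ltW d0)// !sqrtrV ?(ltW p0)// -/sd.
  have s60 : 0 < Num.sqrt 6 :> R by rewrite sqrtr_gt0.
  have sp0 : 0 < Num.sqrt pi :> R by rewrite sqrtr_gt0.
  rewrite -[in 2 / pi](sqr_sqrtr (ltW p0)).
  move: (Num.sqrt 6) s60 (Num.sqrt pi) sp0 => s s60 p sp0.
  by field; rewrite !gt_eqF.
rewrite -mulrBr normrM ger0_norm; last first.
  by rewrite mulr_ge0 ?divr_ge0 ?(ltW sd0) ?(ltW p0).
have h := sincint_gaussint_dist x qd q0.
apply: (le_trans (ler_wpM2l _ h)).
  by rewrite mulr_ge0 ?divr_ge0 ?(ltW sd0) ?(ltW p0).
have dq' : d%:R <= 25 * q%:R :> R by rewrite -natrM ler_nat.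
set sq : R := Num.sqrt q%:R.
have sq0 : 0 < sq by rewrite sqrtr_gt0.
have ssq : sd <= 5 * sq.
  rewrite -(@ler_pXn2r _ 2) ?nnegrE ?mulr_ge0 ?(ltW sd0) ?(ltW sq0)//.
  rewrite sdE exprMn /sq sqr_sqrtr ?(ltW q1)//; lra.
have -> : sd * (2 / pi) * (16 * pi * d%:R / (q%:R ^+ 2 * sq)) =
    32 * (d%:R / q%:R) ^+ 2 * (sd / sq) / d%:R.
  clear p0 h; move: pi pn0 => p pn0.
  by field; rewrite pn0 !gt_eqF.
rewrite ler_wpM2r ?invr_ge0 ?(ltW d0)//.
rewrite ler_pM ?mulr_ge0 ?divr_ge0 ?invr_ge0 ?sqr_ge0 ?(ltW sd0) ?(ltW sq0)//;
  last first.
  by rewrite ler_pdivrMr.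
rewrite ler_wpM2l// lerXn2r ?nnegrE ?divr_ge0 ?(ltW d0) ?(ltW q1)//.
by rewrite ler_pdivrMr.
Qed.

Lemma ceil_dist (y : R) : 0 <= y -> `| (`|Num.ceil y|%N)%:R - y | <= 1.
Proof.
move=> y0.
have c0 : (0 <= Num.ceil y)%R by rewrite ceil_ge0 (lt_le_trans _ y0).
rewrite natr_absz (ger0_norm c0).
have /andP[] := ceil_itv y; rewrite intrB => h1 h2.
by rewrite ger0_norm ?subr_ge0//; lra.
Qed.

End eulerian_limit.

Theorem theorem3p5 (R : realType) :
  exists N : nat, forall d : nat, (N < d)%N ->
  forall t : R, 0 <= t -> t < Num.sqrt d%:R / 2 ->
  `| Num.sqrt d%:R / (d.-1)`!%:R
       * (eulerian d `|Num.ceil (d%:R / 2 - Num.sqrt d%:R * t)|%N)%:R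
     - Num.sqrt (6 / pi) * expR (- (6 * t ^+ 2)) |
  <= 7 * expR (12 / Num.sqrt d%:R) / Num.sqrt (pi * d%:R).
Proof.
pose K : R := 32 * 25 ^+ 2 * 5.
(* The bound pi K^2 <= d is what makes K / d at most 1 / sqrt (pi d). *)
exists (12 + Num.bound (pi * K ^+ 2))%N => d Nd t t0 td.
have p0 : 0 < pi :> R := pi_gt0 R.
have K0 : 0 <= K by rewrite !mulr_ge0.
have d12 : (12 <= d)%N by rewrite (leq_trans _ (ltnW Nd))// leq_addr.
have d0 : 0 < d%:R :> R by rewrite ltr0n (leq_trans _ d12).
have Kd : pi * K ^+ 2 <= d%:R.
  apply: ltW; apply: lt_le_trans (archi_boundP _) _.
    by rewrite mulr_ge0 ?sqr_ge0 ?ltW.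
  by rewrite ler_nat (leq_trans _ (ltnW Nd))// leq_addl.
set sd : R := Num.sqrt d%:R in td *.
have sd0 : 0 < sd by rewrite sqrtr_gt0.
have sdE : sd ^+ 2 = d%:R by rewrite sqr_sqrtr// ltW.
set y : R := d%:R / 2 - sd * t.
have y0 : 0 <= y.
  have -> : y = sd * (sd / 2 - t) by rewrite /y -sdE; ring.
  by rewrite mulr_ge0 ?subr_ge0 ?ltW.
set i := `|Num.ceil y|%N.
have iy : `|i%:R - y| <= 1 := ceil_dist y0.
have E1 := @eulerian_gauss_dist R d i d12; rewrite -/sd -/K in E1.
set a : R := (i%:R - d%:R / 2) / sd in E1.
have E2 := gauss6_lipschitz (- a) t; rewrite sqrrN in E2.
(* As [a] is close to - t, the evenness of the Gaussian is used to compare it at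
   [- a] and [t], which differ by the rounding error divided by sqrt d. *)
have at1 : `|- a - t| <= sd^-1.
  have -> : - a - t = - ((i%:R - y) / sd).
    by rewrite /a /y; field; rewrite gt_eqF.
  by rewrite normrN normrM normfV (gtr0_norm sd0) ler_piMl// invr_ge0 ltW.
set s6p : R := Num.sqrt (6 / pi) in E1 *.
have sp0 : 0 < Num.sqrt pi :> R by rewrite sqrtr_gt0.
have s6pE : s6p * Num.sqrt 6 = 6 / Num.sqrt pi.
  by rewrite /s6p sqrtrM// sqrtrV ?(ltW p0)// mulrAC -expr2 sqr_sqrtr.
have spd : Num.sqrt (pi * d%:R) = Num.sqrt pi * sd by rewrite sqrtrM ?ltW.
set E := _ / _ * _ in E1 *.
have B1 : K / d%:R <= 1 / Num.sqrt (pi * d%:R).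
  rewrite spd -sdE ler_pdivrMr ?exprn_gt0// mulrAC ler_pdivlMr ?mulr_gt0// mul1r.
  rewrite expr2 mulrA ler_wpM2r ?(ltW sd0)// mulrC.
  rewrite -(@ler_pXn2r _ 2) ?nnegrE ?mulr_ge0 ?(ltW sp0) ?(ltW sd0)//.
  by rewrite exprMn sqr_sqrtr ?(ltW p0)// sdE.
have B2 : `|s6p * expR (- (6 * a ^+ 2)) - s6p * expR (- (6 * t ^+ 2))|
    <= 6 / Num.sqrt (pi * d%:R).
  rewrite -mulrBr normrM (ger0_norm (sqrtr_ge0 _)).
  apply: (le_trans (ler_wpM2l (sqrtr_ge0 _) E2)).
  rewrite mulrA s6pE spd invfM mulrA ler_wpM2l//.
apply: (@le_trans _ _ (7 / Num.sqrt (pi * d%:R))); last first.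
  rewrite ler_wpM2r ?invr_ge0 ?sqrtr_ge0//.
  rewrite ler_peMr// -[leLHS]expR0 ler_expR divr_ge0// ltW//.
rewrite (le_trans (ler_distD (s6p * expR (- (6 * a ^+ 2))) _ _))//.
apply: (le_trans (lerD E1 B2)).
move: (Num.sqrt (pi * d%:R)) (K / d%:R) B1 => S k B1; lra.
Qed.
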